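(* Let $k\in\mathbb{N}$. For every odd prime $p$, every $n\geqslant 1$, every function $F:A_F\to\mathbb{Z}/p^n\mathbb{Z}$ in the class $\mathcal{F}_k(\mathbb{Z}/p^n\mathbb{Z})$ (defined in the context), and every weight $g:A_F\to\mathbb{C}$ that is invariant under translations by $p^{\kappa_0(F)}\mathbb{Z}/p^n\mathbb{Z}$ and satisfies $|g|\ll_k 1$, \[ \sum_{x\in A_F}g(x)\,e\Big(\frac{F(x)}{p^n}\Big)\ll_k p^{\,n-\frac{n-\Delta_k(F)-1}{k}+1}, \] where $\Delta_k(F)\leqslant n$ is defined in the context.
   Context: $e(z)=e^{2\pi iz}$; $u\ll_k v$ means $|u|\leqslant C v$ with a constant $C$ depending only on $k$. Notation: $x^{+}=\max(x,0)$, $(a)_m=\prod_{j=0}^{m-1}(a-j)$. For $y\in\mathbb{Z}/p^n\mathbb{Z}$, $\mathrm{ord}_p\,y\in\{0,\dots,n\}$ is the largest $e\leqslant n$ with $y\in p^e\mathbb{Z}/p^n\mathbb{Z}$. The class $\mathcal{F}_k(\mathbb{Z}/p^n\mathbb{Z})$. For each $k\geqslant 1$ fix, once and for all, constants $\rho_k(p)\in\mathbb{Z}_{\geqslant 0}$ ($p$ prime) with $\rho_k(p)=0$ for all sufficiently large primes $p\geqslant p_0(k)$; constants depending on $k$ may depend on this choice. Let $\kappa_0=\kappa_0(F)=1+\rho_k(p)\leqslant n$, and let $A_F\subseteq\mathbb{Z}/p^n\mathbb{Z}$ be invariant under translations by $p^{\kappa_0}\mathbb{Z}/p^n\mathbb{Z}$.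 A function $F:A_F\to\mathbb{Z}/p^n\mathbb{Z}$ belongs to $\mathcal{F}_k(\mathbb{Z}/p^n\mathbb{Z})$ if: (1) There is a system of functions $\tilde F^{(m)}:A_F\to\mathbb{Z}/p^n\mathbb{Z}$ ($m\geqslant 0$) with $\tilde F^{(0)}=F$ such that, writing $F^{(m)}(x)=m!\,\tilde F^{(m)}(x)$ and interpreting $F^{(m+i)}(x)/i!$ as $(m+i)_m\tilde F^{(m+i)}(x)$ (in particular $F^{(i)}(x)/i!=\tilde F^{(i)}(x)$), for every $m\in\mathbb{Z}_{\geqslant 0}$, $x\in A_F$, $\kappa\geqslant\kappa_0$, $t\in\mathbb{Z}/p^n\mathbb{Z}$, and $1\leqslant j<n$, \[ F^{(m)}(x+p^{\kappa}t)\equiv\sum_{i=0}^{j}\frac{F^{(m+i)}(x)}{i!}p^{i\kappa}t^i\pmod{p^{\min((j+1)\kappa,n)}}. \] (2) For every $x\in A_F$, denoting $\Delta_k(F;x)=\min_{1\leqslant i\leqslant k}\min\big(n,\mathrm{ord}_p\frac{F^{(i)}(x)}{i!}\big)$, one has $p^{\min(n,\Delta_k(F;x)+1)}\mid p^{(i-k)^{+}\kappa_0}\frac{F^{(i)}(x)}{i!}$ for every $i>k$. For such $F$ (with its system $\tilde F^{(m)}$), $\Delta_k(F)=\max_{x\in A_F}\Delta_k(F;x)$. *)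

(* Defs.v *)
From mathcomp Require Import all_boot all_order all_algebra.
From mathcomp Require Import complex.
From mathcomp Require Import reals sequences exp trigo.

Set Implicit Arguments.
Unset Strict Implicit.
Unset Printing Implicit Defensive.

Import Order.TTheory GRing.Theory Num.Theory.

Local Open Scope ring_scope.
Local Open Scope complex_scope.

(* The complex exponential and e(z) = exp (2 pi i z). *)
Definition cexp (R : realType) (z : R[i]) : R[i] :=
  let: a +i* b := z in (expR a)%:C * (cos b +i* sin b).

Definition e2pi (R : realType) (z : R[i]) : R[i] :=
  cexp (2 * (pi : R)%:C * 'i * z).

(* Z/p^n is 'Z_(p ^ n); this is the intended ring as soon as p > 1 and n > 0. *)

(* y belongs to p^e Z/p^n *)
Definition pdvd (p n e : nat) (y : 'Z_(p ^ n)) : bool :=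
  [exists c : 'Z_(p ^ n), y == p%:R ^+ e * c].

Definition pord (p n : nat) (y : 'Z_(p ^ n)) : nat :=
  (\max_(e < n.+1 | pdvd e y) e)%N.

Definition kappa0 (rho : nat -> nat -> nat) (k p : nat) : nat :=
  (1 + rho k p)%N.

Definition shift_inv (p n kap : nat) (A : {set 'Z_(p ^ n)}) : Prop :=
  forall x t : 'Z_(p ^ n), x \in A -> x + p%:R ^+ kap * t \in A.

(* Functions on A are total functions whose values outside A are ignored.
   Ft m is the function written F tilde ^(m), so F^(m) = m! Ft m, and
   F^(m+i)/i! stands for (m+i)_m Ft (m+i). *)
Definition taylor_system (p n kap0 : nat) (A : {set 'Z_(p ^ n)})
    (Ft : nat -> 'Z_(p ^ n) -> 'Z_(p ^ n)) : Prop :=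
  forall (m kap j : nat) (x t : 'Z_(p ^ n)),
    x \in A -> (kap0 <= kap)%N -> (1 <= j < n)%N ->
    pdvd (minn (j.+1 * kap) n)
      (Ft m (x + p%:R ^+ kap * t) *+ m`!
       - \sum_(i < j.+1)
           (Ft (m + i)%N x *+ (m + i) ^_ m) * p%:R ^+ (i * kap) * t ^+ i).

Definition Delta_at (p n k : nat) (Ft : nat -> 'Z_(p ^ n) -> 'Z_(p ^ n))
    (x : 'Z_(p ^ n)) : nat :=
  \big[minn/n]_(1 <= i < k.+1) minn n (pord (Ft i x)).

Definition Delta (p n k : nat) (A : {set 'Z_(p ^ n)})
    (Ft : nat -> 'Z_(p ^ n) -> 'Z_(p ^ n)) : nat :=
  (\max_(x in A) Delta_at k Ft x)%N.

(* F : A -> Z/p^n belongs to the class F_k(Z/p^n), as witnessed by the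
   system Ft. *)
Record in_class (rho : nat -> nat -> nat) (k p n : nat)
    (A : {set 'Z_(p ^ n)}) (F : 'Z_(p ^ n) -> 'Z_(p ^ n))
    (Ft : nat -> 'Z_(p ^ n) -> 'Z_(p ^ n)) : Prop := InClass {
  class_kappa0_le : (kappa0 rho k p <= n)%N;
  class_domain : shift_inv (kappa0 rho k p) A;
  class_system0 : {in A, Ft 0%N =1 F};
  class_taylor : taylor_system (kappa0 rho k p) A Ft;
  class_tail : forall (x : 'Z_(p ^ n)) (i : nat), x \in A -> (k < i)%N ->
    pdvd (minn n (Delta_at k Ft x).+1)
      (p%:R ^+ ((i - k) * kappa0 rho k p) * Ft i x)
}.

(* Main.v *)
Require Import Defs.
From mathcomp Require Import all_boot all_order all_algebra.
From mathcomp Require Import complex.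
From mathcomp Require Import reals sequences exp trigo.
From mathcomp Require Import zify ring lra.

(* On each progression x + p^kap t the function F is a polynomial f in t of
   Taylor coefficients Ft i x * p^(i kap), and the tail condition says that,
   after removing the constant and a power p^mu with mu <= Delta + k kap, f has
   degree between 1 and k mod p.  Such a sum mod p^n is bounded in the manner of
   Hua: writing h' = p^tau g with g nonzero mod p, only the residues xi with
   g(xi) = 0 mod p contribute; substituting xi + p t gains a factor p^-1 and
   divides out p^s with s <= k, while the multiplicities of the roots of g
   control the number of branches.  The loss p^(1/k) allowed by the theorem
   makes the trivial bound sufficient at modulus p, so Weil's bound is not
   needed.  For the finitely many small p one uses progressions of step
   p^(kappa0 + 1), which also bounds the degree of g mod p; the cost is a
   constant. *)

Set Implicit Arguments.
Unset Strict Implicit.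
Unset Printing Implicit Defensive.

Import Order.TTheory GRing.Theory Num.Theory.

Local Open Scope ring_scope.
Local Open Scope complex_scope.

(** * Sums of periodic sequences *)

Section PeriodicSums.
Variables (V : nmodType) (N : nat) (G : nat -> V).
Hypothesis G_periodic : forall j, G (j + N)%N = G j.

Lemma sum_periodic_shift c :
  \sum_(0 <= j < N) G (j + c)%N = \sum_(0 <= j < N) G j.
Proof.
elim: c => [|c <-]; first by apply: eq_bigr => j _; rewrite addn0.
case: N G_periodic => [|M] per; first by rewrite !big_geq.
rewrite big_nat_recr //= [RHS]big_nat_recl //= addrC; congr (_ + _).
  by rewrite addnS -addSn addnC per.
by apply: eq_bigr => j _; rewrite addnS.
Qed.

Lemma sum_periodic_muln m :
  \sum_(0 <= j < m * N) G j = (\sum_(0 <= j < N) G j) *+ m.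
Proof.
rewrite big_nat_mul (eq_bigr (fun=> \sum_(0 <= j < N) G j)).
  by rewrite sumr_const_nat subn0.
move=> i _; rewrite -{1}[(i * N)%N]add0n big_addn mulSn addnK.
by rewrite sum_periodic_shift.
Qed.

(** The indices [xi + p * t] run once over [0 <= j < p * N], that is over [p] periods. Letting [t]
    run over a full period in each class, at the cost of a factor [p], keeps the inner sums of the
    same shape as the original one. *)
Lemma sum_periodic_residues p :
  \sum_(0 <= xi < p) \sum_(0 <= t < N) G (xi + p * t)%N
  = (\sum_(0 <= j < N) G j) *+ p.
Proof.
rewrite exchange_big -sum_periodic_muln mulnC big_nat_mul.
apply: eq_bigr => t _; rewrite -{1}[(t * p)%N]add0n big_addn mulSn addnK.
by apply: eq_bigr => xi _; rewrite [(p * t)%N]mulnC.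
Qed.

End PeriodicSums.

(** * Content at p and reduction mod p of integer polynomials *)

Section ReductionModP.
Variable p : nat.
Hypothesis p_prime : prime p.
Implicit Types h g : {poly int}.

Definition redp h : {poly 'F_p} := map_poly intr h.

Lemma intr_Fp_eq0 (a : int) : ((a%:~R : 'F_p) == 0) = (p %| a)%Z.
Proof. by rewrite (dvdz_pcharf (pchar_Fp p_prime)). Qed.

Lemma dvdz_expM_prime e (a b : int) :
  ~~ (p %| a)%Z -> (p%:Z ^+ e %| a * b)%Z = (p%:Z ^+ e %| b)%Z.
Proof.
move=> pa; apply: Gauss_dvdzr; rewrite coprimezE abszX coprimeXl //.
by rewrite prime_coprime.
Qed.

Lemma pz_neq0 : p%:Z != 0. Proof. by rewrite -lt0n prime_gt0. Qed.

Lemma pzX_neq0 e : p%:Z ^+ e != 0.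
Proof. by rewrite expf_neq0 // pz_neq0. Qed.

Lemma dvdz_pX a b : (p%:Z ^+ a %| p%:Z ^+ b)%Z = (a <= b)%N.
Proof. by apply: dvdz_Pexp2l; rewrite ger0_norm // ltz_nat prime_gt1. Qed.

Lemma size_redp_leP h d :
  reflect (forall i, (d <= i)%N -> (p %| h`_i)%Z) (size (redp h) <= d)%N.
Proof.
apply: (iffP (leq_sizeP _ _)) => H i /H; rewrite coef_map /=.
  by move/eqP; rewrite intr_Fp_eq0.
by move=> ?; apply/eqP; rewrite intr_Fp_eq0.
Qed.

Lemma redp_eq0P h : reflect (forall i, (p %| h`_i)%Z) (redp h == 0).
Proof.
rewrite -size_poly_eq0 -leqn0.
by apply: (iffP (size_redp_leP h 0)) => H i //; apply: H.
Qed.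

(** As long as all coefficients are divisible by [p], dividing by [p] shrinks the leading
    coefficient, so induction on its absolute value terminates. *)
Lemma redp_content h :
  h != 0 -> exists a g, h = p%:Z ^+ a *: g /\ redp g != 0.
Proof.
have [m] := ubnP `|lead_coef h|; elim: m h => // m IHm h lt_m h_neq0.
have [/eqP/redp_eq0P h0|h_n0] := eqVneq (redp h) 0; last first.
  by exists 0, h; rewrite expr0 scale1r.
pose g := \poly_(i < size h) (h`_i %/ p)%Z.
have hE : h = p%:Z *: g.
  apply/polyP=> i; rewrite coefZ coef_poly; case: ltnP => [_|le_i].
    by rewrite mulrC divzK.
  by rewrite nth_default // mulr0.
have g_neq0 : g != 0 by apply: contraNneq h_neq0 => g0; rewrite hE g0 scaler0.
have lc : lead_coef h = p%:Z * lead_coef g by rewrite {1}hE lead_coefZ.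
have [|a [g' [gE red_g']]] := IHm g _ g_neq0; last first.
  by exists a.+1, g'; rewrite hE gE exprS -scalerA.
move: lt_m; rewrite lc abszM /= ltnS; apply: leq_trans.
rewrite -{1}[`|lead_coef g|%N]mul1n ltn_pmul2r ?prime_gt1 //.
by rewrite absz_gt0 lead_coef_eq0.
Qed.

Lemma redp_content_uniq a b g h :
  redp g != 0 -> redp h != 0 -> p%:Z ^+ a *: g = p%:Z ^+ b *: h ->
  a = b /\ g = h.
Proof.
have le_exp c d u v : redp u != 0 -> p%:Z ^+ c *: u = p%:Z ^+ d *: v ->
    (d <= c)%N.
  move=> u0 E; rewrite leqNgt; apply: contra u0 => lt_cd.
  apply/redp_eq0P=> i; have /polyP/(_ i) := E; rewrite !coefZ.
  rewrite -(subnKC lt_cd) addSn -addnS exprD -mulrA.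
  by move=> /(mulfI (pzX_neq0 c)) ->; rewrite exprS -mulrA dvdz_mulr.
move=> g0 h0 E; have ab : a = b.
  by apply/eqP; rewrite eqn_leq (le_exp _ _ _ _ h0 (esym E)) (le_exp _ _ _ _ g0 E).
split=> //; apply/polyP=> i; have /polyP/(_ i) := E.
by rewrite !coefZ ab => /(mulfI (pzX_neq0 b)).
Qed.

Lemma coef_comp_scaleX (R : comNzRingType) (e : {poly R}) (c : R) i :
  (e \Po (c *: 'X))`_i = e`_i * c ^+ i.
Proof.
rewrite comp_polyE (eq_bigr (fun j : 'I_(size e) => (e`_j * c ^+ j) *: 'X^j)).
  rewrite -(poly_def (size e) (fun j => e`_j * c ^+ j)) coef_poly.
  by case: ltnP => // le_i; rewrite nth_default // mul0r.
by move=> j _; rewrite exprZn scalerA.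
Qed.

(* Substituting p X damps the degree-i coefficient by p^i, so the reduction of
   the normalised polynomial has degree at most that of any unit coefficient. *)
Lemma redp_scaleX (e : {poly int}) d :
  ~~ (p %| e`_d)%Z ->
  exists s g, [/\ e \Po (p%:Z *: 'X) = p%:Z ^+ s *: g, redp g != 0,
    (s <= d)%N & (size (redp g) <= d.+1)%N].
Proof.
move=> ed.
have e_neq0 : e \Po (p%:Z *: 'X) != 0.
  apply/eqP=> /polyP/(_ d)/eqP; rewrite coef_comp_scaleX coef0 mulf_eq0.
  rewrite (negPf (pzX_neq0 d)) orbF => /eqP e0.
  by rewrite e0 dvdz0 in ed.
have [s [g [E g0]]] := redp_content e_neq0.
have Ei i : e`_i * p%:Z ^+ i = p%:Z ^+ s * g`_i.
  by rewrite -coefZ -E coef_comp_scaleX.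
have le_sd : (s <= d)%N.
  by rewrite -dvdz_pX -(dvdz_expM_prime _ _ ed) Ei dvdz_mulr.
exists s, g; split=> //; apply/size_redp_leP => i lt_di.
have lt_si : (s < i)%N by apply: leq_ltn_trans lt_di.
have := Ei i; rewrite -(subnKC lt_si) addSn -addnS exprD mulrCA.
by move=> /(mulfI (pzX_neq0 s)) <-; rewrite exprS mulrCA dvdz_mulr.
Qed.

End ReductionModP.

(** * Root multiplicities over a field *)

Section Multiplicities.
Variable F : fieldType.
Implicit Types (g : {poly F}) (x : F).

Lemma prod_XsubC_mup_dvdp g (s : seq F) : g != 0 -> uniq s ->
  \prod_(x <- s) ('X - x%:P) ^+ mup x g %| g.
Proof.
move=> g0; elim: s => [|x s IHs] /=; first by rewrite big_nil dvd1p.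
case/andP=> x_s /IHs dvd_s; rewrite big_cons Gauss_dvdp.
  by rewrite dvd_s andbT -mup_geq.
rewrite coprimep_expl // coprimep_sym coprimep_XsubC.
rewrite /root horner_prod prodf_seq_neq0; apply/allP => y y_s /=.
rewrite horner_exp expf_neq0 // hornerXsubC subr_eq0.
by apply: contraNneq x_s => ->.
Qed.

Lemma sum_mup_le g (s : seq F) : g != 0 -> uniq s ->
  (\sum_(x <- s) mup x g <= (size g).-1)%N.
Proof.
move=> g0 s_uniq; have := dvdp_leq g0 (prod_XsubC_mup_dvdp g0 s_uniq).
suff -> : size (\prod_(x <- s) ('X - x%:P) ^+ mup x g)
            = (\sum_(x <- s) mup x g).+1 by case: (size g).
elim: s {s_uniq} => [|x s IHs]; first by rewrite !big_nil size_poly1.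
rewrite !big_cons size_Mmonic ?IHs ?size_exp_XsubC ?addSn ?addnS //.
  by rewrite expf_neq0 // polyXsubC_eq0.
by rewrite monic_prod // => y _; rewrite monic_exp ?monicXsubC.
Qed.

(** With [g = q * ('X - x) ^ mup x g], this coefficient is [q.[x]]. It supplies the unit coefficient
    from which [redp_scaleX] bounds a degree by a multiplicity. *)
Lemma coef_mup_neq0 g x : g != 0 -> (g \Po ('X + x%:P))`_(mup x g) != 0.
Proof.
move=> g0; have /dvdpP[q gE] : ('X - x%:P) ^+ mup x g %| g by rewrite -mup_geq.
have q_x : q.[x] != 0.
  apply/negP => /eqP/rootP/factor_theorem[r qE].
  have := mup_geq x (mup x g).+1 g0.
  by rewrite ltnn {2}gE qE -mulrA -exprS dvdp_mulIr.
rewrite {1}gE rmorphM rmorphXn /= rmorphB /= comp_polyX comp_polyC addrK.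
rewrite coefMXn ltnn subnn -horner_coef0 horner_comp.
by rewrite hornerD hornerX hornerC add0r.
Qed.

End Multiplicities.

(** * Taylor expansion with p-adic control of the remainder *)

Lemma nderivnS_deriv (R : nzRingType) (h : {poly R}) i :
  h^`N(i.+1) *+ i.+1 = h^`()^`N(i).
Proof.
apply/polyP=> j; rewrite coefMn !coef_nderivn coef_deriv addSn.
by rewrite -!mulrnA mulnC -mul_bin_diag mulnC.
Qed.

(** Otherwise [p ^ i.+1] divides [i.+2], against [3 ^ i.+1 > i.+2]. For [p = 2] it fails at [i = 0];
    oddness of [p] enters the argument here. *)
Lemma logn_lt_pred p i : prime p -> odd p -> (logn p i.+2 <= i)%N.
Proof.
move=> p_pr p_odd; rewrite leqNgt; apply/negP => lt_i.
have p_ge3 : (2 < p)%N by rewrite odd_prime_gt2.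
have : (p ^ i.+1 <= i.+2)%N.
  apply: leq_trans (dvdn_leq _ (pfactor_dvdnn p i.+2)) => //.
  by rewrite leq_pexp2l // prime_gt0.
rewrite leqNgt => /negP; apply; apply: (@leq_trans (3 ^ i.+1)).
  by elim: i {lt_i} => // i IHi; rewrite expnS; lia.
by rewrite leq_exp2r.
Qed.

(* The Taylor term of degree i >= 2 has denominator at most p^(v_p i), and
   v_p i <= i - 2 for p odd. *)
Lemma horner_translate_pX p (h g : {poly int}) tau q (y : int) :
  prime p -> odd p -> (0 < q)%N -> h^`() = p%:Z ^+ tau *: g ->
  (p%:Z ^+ (tau + q).+1 %|
     h.[y + p%:Z ^+ q] - (h.[y] + p%:Z ^+ (tau + q) * g.[y]))%Z.
Proof.
move=> p_pr p_odd q_gt0 hg.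
rewrite (@nderiv_taylor_wide _ (size h).+2); last 2 first.
- exact: mulrC.
- by rewrite -addn2 leq_addr.
rewrite !big_ord_recl /= nderivn0 nderivn1 expr0 mulr1 expr1 hg hornerZ.
rewrite addrA (_ : _ * g.[y] * _ = p%:Z ^+ (tau + q) * g.[y]); last first.
  by rewrite exprD mulrAC.
rewrite [X in X - _]addrC addrK; apply: rpred_sum => i _; rewrite /bump /= !add1n.
set e := i.+2; pose v := logn p e.
have [u p_u eE] := pfactor_coprime p_pr (isT : (0 < e)%N).
have pu : ~~ (p %| u%:Z)%Z by rewrite /dvdz /= -prime_coprime.
rewrite -(dvdz_expM_prime p_pr _ _ pu) -(dvdz_mul2l (pzX_neq0 p_pr v)).
have -> : p%:Z ^+ v * (u%:Z * (h^`N(e).[y] * p%:Z ^+ q ^+ e))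
          = p%:Z ^+ (tau + q * e) * g^`N(i.+1).[y].
  have -> : p%:Z ^+ (tau + q * e) * g^`N(i.+1).[y]
            = (h^`N(e) *+ e).[y] * p%:Z ^+ q ^+ e.
    by rewrite nderivnS_deriv hg nderivnZ hornerZ exprD exprM; ring.
  have eR : e%:R = u%:Z * p%:Z ^+ v :> int by rewrite eE natrM natrX !natz.
  by rewrite hornerMn -mulr_natl eR; ring.
rewrite -exprD dvdz_mulr // dvdz_pX //.
(* It remains to see [v + q + 1 <= q * e], which follows from [v <= e - 2] and [q >= 1]. *)
have := logn_lt_pred i p_pr p_odd; rewrite -/e -/v.
by rewrite /e; nia.
Qed.

(** * Additive characters and cancellation away from critical residues *)

Lemma dvdz_horner_sub (d a b : int) (h : {poly int}) :
  (d %| a - b)%Z -> (d %| h.[a] - h.[b])%Z.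
Proof.
move=> dvd_ab; elim/poly_ind: h => [|h c IHh]; first by rewrite !horner0 subrr.
rewrite !hornerMXaddC (_ : _ - _ = (h.[a] - h.[b]) * a + h.[b] * (a - b)).
  by apply: rpredD; [apply: dvdz_mulr | apply: dvdz_mull].
by ring.
Qed.

(** A faithful character of Z/N pulled back to the integers, so that it applies to values of integer
    polynomials. The exact kernel gives both periodicity mod [N] and [psi a != 1] off the multiples
    of [N]. *)
Definition additive_character (C : numFieldType) (N : nat) (psi : int -> C) :=
  [/\ {morph psi : a b / a + b >-> a * b}, forall a, `|psi a| = 1
    & forall a, (psi a == 1) = (N %| a)%Z].

Section CharacterSums.
Variables (C : numFieldType) (p n : nat) (psi : int -> C).
Hypotheses (p_prime : prime p) (p_odd : odd p).
Hypothesis psi_char : additive_character (p ^ n) psi.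

Let psiD : {morph psi : a b / a + b >-> a * b}. Proof. by case: psi_char. Qed.
Let psi_norm a : `|psi a| = 1. Proof. by case: psi_char. Qed.

Lemma psi_eq a b : (p%:Z ^+ n %| a - b)%Z -> psi a = psi b.
Proof.
case: psi_char => _ _ psi1; rewrite -[p%:Z]natz -natrX natz -psi1 => /eqP E.
by rewrite -[a in LHS](subrK b) psiD E mul1r.
Qed.

Lemma norm_char_sum_le (G : nat -> int) N :
  `|\sum_(0 <= j < N) psi (G j)| <= N%:R.
Proof.
apply: le_trans (ler_norm_sum _ _ _) _.
by rewrite (eq_bigr (fun=> 1)) // sumr_const_nat subn0.
Qed.

Lemma psi_poly_periodic (h : {poly int}) mu (j : nat) :
  psi (p%:Z ^+ mu * h.[(j + p ^ n)%N]) = psi (p%:Z ^+ mu * h.[j]).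
Proof.
apply: psi_eq; rewrite -mulrBr dvdz_mull // dvdz_horner_sub //.
by rewrite PoszD addrC addKr -[(p ^ n)%N%:Z]natz natrX natz.
Qed.

(* Translating t by p^(q-1), with q = n - 1 - mu - tau, multiplies the sum by
   psi (p^(n-1) g(xi)), which is not 1. *)
Lemma noncritical_sum_eq0 mu tau (h g : {poly int}) (xi : nat) :
  h^`() = p%:Z ^+ tau *: g -> (mu + tau + 2 <= n)%N -> ~~ (p %| g.[xi])%Z ->
  \sum_(0 <= t < p ^ n) psi (p%:Z ^+ mu * h.[(xi + p * t)%N]) = 0.
Proof.
move=> hg le_n g_xi; set S := \sum_(_ <= _ < _) _.
have [q q_gt0 nE] : exists2 q, (0 < q)%N & n = (mu + (tau + q).+1)%N.
  by exists (n - mu - tau - 1)%N; lia.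
pose z := psi (p%:Z ^+ (mu + (tau + q)) * g.[xi]).
have z_neq1 : z != 1.
  case: psi_char => _ _ psi1; rewrite /z psi1 -[(p ^ n)%N%:Z]natz natrX natz.
  rewrite nE addnS exprSr dvdz_mul2l //; exact: pzX_neq0.
suff E : S = S * z.
  have /eqP : S * (1 - z) = 0 by rewrite mulrBr mulr1 -E subrr.
  by rewrite mulf_eq0 subr_eq0 [1 == z]eq_sym (negPf z_neq1) orbF => /eqP.
pose G t := psi (p%:Z ^+ mu * h.[(xi + p * t)%N]).
have perG t : G (t + p ^ n)%N = G t.
  rewrite /G; apply: psi_eq; rewrite -mulrBr dvdz_mull // dvdz_horner_sub //.
  rewrite !PoszD !PoszM PoszD -[(p ^ n)%N%:Z]natz natrX natz.
  by rewrite (_ : _ - _ = p%:Z * p%:Z ^+ n) ?dvdz_mull //; ring.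
rewrite {1}/S -(sum_periodic_shift perG (p ^ q.-1)) mulr_suml.
apply: eq_bigr => t _; rewrite /G /z -psiD; apply: psi_eq.
set y : int := (xi + p * t)%N.
have -> : ((xi + p * (t + p ^ q.-1))%N : int) = y + p%:Z ^+ q.
  rewrite /y mulnDr addnA -expnS prednK // PoszD.
  by rewrite -[(p ^ q)%N%:Z]natz natrX natz.
(* Two errors must vanish mod [p ^ n]: the Taylor remainder, divisible by [p ^ (tau + q).+1], and
   the replacement of [g.[y]] by [g.[xi]], a multiple of [p] times [p ^ (tau + q)]. *)
have := horner_translate_pX y p_prime p_odd q_gt0 hg.
have : (p %| g.[y] - g.[xi])%Z.
  by apply: dvdz_horner_sub; rewrite /y PoszD PoszM addrC addKr dvdz_mulr.
rewrite nE !(exprD _ mu) => /dvdzP[a aE] /dvdzP[b bE].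
rewrite -mulrA -mulrDr -mulrBr dvdz_mul2l ?pzX_neq0 //.
rewrite (_ : _ - _ = (b + a) * p%:Z ^+ (tau + q).+1) ?dvdz_mull //.
by move: aE bE; rewrite exprS; set P := p%:Z ^+ (tau + q); nia.
Qed.

End CharacterSums.

(** * Rescaling at a critical residue *)

Lemma redp_comp_translate p (h : {poly int}) (x : int) :
  redp p (h \Po ('X + x%:P)) = redp p h \Po ('X + (x%:~R)%:P).
Proof. by rewrite /redp map_comp_poly rmorphD /= map_polyX map_polyC. Qed.

Lemma deriv_content_le p (h g : {poly int}) tau d t0 :
  prime p -> h^`() = p%:Z ^+ tau *: g -> (0 < d)%N -> ~~ (p %| h`_d)%Z ->
  (d < p ^ t0.+1)%N -> (tau <= t0)%N.
Proof.
move=> p_pr hg d_gt0 h_d d_lt.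
have : (p%:Z ^+ tau %| d%:Z)%Z.
  rewrite -(dvdz_expM_prime p_pr _ _ h_d).
  have -> : h`_d * d%:Z = h`_d *+ d by rewrite -mulr_natr natz.
  have /polyP/(_ d.-1) := hg; rewrite coefZ coef_deriv prednK // => ->.
  by rewrite dvdz_mulr.
rewrite -[p%:Z]natz -natrX natz => /(dvdn_leq d_gt0) le_d.
have /(leq_ltn_trans le_d) := d_lt.
by rewrite ltn_exp2l ?prime_gt1.
Qed.

(** Both bounds come from [redp_scaleX]: for [h] translated by [xi], less its constant term, the
    unit coefficient sits at the degree mod [p], giving [s <= k]; for the translate of [g] it sits
    at the multiplicity of the root [xi], giving the degree of [g1]. *)
Lemma critical_point_rescale p k (h g : {poly int}) tau (xi : int) :
  prime p -> h^`() = p%:Z ^+ tau *: g -> redp p g != 0 ->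
  (1 < size (redp p h) <= k.+1)%N ->
  exists s h1 tau1 g1,
   [/\ forall t, h.[xi + p%:Z * t] = h.[xi] + p%:Z ^+ s * h1.[t],
       (0 < s <= k)%N,
       h1^`() = p%:Z ^+ tau1 *: g1 & redp p g1 != 0] /\
   [/\ (1 < size (redp p h1) <= k.+1)%N &
       (size (redp p g1) <= (mup xi%:~R (redp p g)).+1)%N].
Proof.
move=> p_pr hg g0 /andP[h_gt1 h_le].
pose tr := 'X + xi%:P; pose sc : {poly int} := p%:Z *: 'X.
pose hx := h \Po tr; pose e := hx - (hx`_0)%:P.
have size_hx : size (redp p hx) = size (redp p h).
  by rewrite redp_comp_translate size_comp_poly2 // size_XaddC.
pose d := (size (redp p h)).-1.
have d_gt0 : (0 < d)%N by rewrite /d; lia.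
have le_dk : (d <= k)%N by rewrite /d; lia.
have eE i : e`_i = if i == 0 then 0 else hx`_i.
  rewrite coefB coefC; case: eqP => [->|_]; first by rewrite subrr.
  by rewrite subr0.
have e_d : ~~ (p %| e`_d)%Z.
  rewrite eE gtn_eqF // -(intr_Fp_eq0 p_pr).
  have -> : (hx`_d)%:~R = lead_coef (redp p hx) :> 'F_p.
    by rewrite lead_coefE size_hx coef_map.
  by rewrite lead_coef_eq0 -size_poly_gt0 size_hx; lia.
have [s [h1 [hE h1_0 le_sd h1_le]]] := redp_scaleX p_pr e_d.
have h1_i i : e`_i * p%:Z ^+ i = p%:Z ^+ s * h1`_i.
  by rewrite -coefZ -hE coef_comp_scaleX.
have h1_00 : h1`_0 = 0.
  have /eqP := h1_i 0; rewrite eE eqxx mul0r eq_sym mulf_eq0.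
  by rewrite (negPf (pzX_neq0 p_pr s)) => /eqP.
have s_gt0 : (0 < s)%N.
  rewrite lt0n; apply: contra h1_0 => /eqP s0; apply/redp_eq0P => // -[|i].
    by rewrite h1_00 dvdz0.
  have := h1_i i.+1; rewrite s0 mul1r => <-.
  by rewrite exprS mulrCA dvdz_mulr.
have h1_gt1 : (1 < size (redp p h1))%N.
  rewrite ltnNge; apply: contra h1_0 => /size_redp_leP-/(_ p_pr) H.
  by apply/redp_eq0P => // -[|i]; [rewrite h1_00 dvdz0 | apply: H].
pose gx := g \Po tr.
have gx_nu : ~~ (p %| gx`_(mup xi%:~R (redp p g)))%Z.
  rewrite -(intr_Fp_eq0 p_pr) -[X in X != 0]coef_map.
  by rewrite -/(redp p gx) redp_comp_translate coef_mup_neq0.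
have [r [g1 [gE g1_0 _ g1_le]]] := redp_scaleX p_pr gx_nu.
(* Chain rule: the derivative of [h.[xi + p X]] is [p * p ^ tau * g.[xi + p X]]. Uniqueness of the
   content then identifies [g1] with the normalised derivative of [h1]. *)
have dh1 : p%:Z ^+ s *: h1^`() = p%:Z ^+ (tau + r).+1 *: g1.
  rewrite -derivZ -hE deriv_comp derivB derivC subr0 /hx deriv_comp hg.
  rewrite derivD derivX derivC addr0 mulr1 derivZ derivX !comp_polyZ gE.
  by rewrite mulr_algr !scalerA exprS exprD mulrA.
have h1'_neq0 : h1^`() != 0.
  apply: contra g1_0 => /eqP h1'0; move: dh1; rewrite h1'0 scaler0.
  move=> /esym/eqP; rewrite scale_poly_eq0 (negPf (pzX_neq0 p_pr _)) => /eqP ->.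
  by rewrite /redp map_poly0.
have [tau1 [g1' [h1'E g1'_0]]] := redp_content p_pr h1'_neq0.
move: dh1; rewrite h1'E scalerA -exprD => /(redp_content_uniq p_pr g1'_0 g1_0).
case=> _ g1'E; exists s, h1, tau1, g1'; split; last first.
  by rewrite h1_gt1 g1'E (leq_trans h1_le).
split=> //; last by rewrite s_gt0 (leq_trans le_sd).
move=> t; have /(congr1 (fun P => P.[t])) := hE.
rewrite hornerZ horner_comp /e hornerD hornerN hornerC /sc hornerZ hornerX.
rewrite -horner_coef0 !horner_comp !hornerD !hornerX !hornerC add0r.
by rewrite [p%:Z * t + xi]addrC => <-; rewrite [RHS]addrC subrK.
Qed.

(** * Recursion over critical residues *)

Section CoreBound.
Variables (C : numFieldType) (p n k t0 : nat) (psi : int -> C) (w : C).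
Hypotheses (p_prime : prime p) (p_odd : odd p).
Hypothesis psi_char : additive_character (p ^ n) psi.
Hypotheses (w_ge1 : 1 <= w) (wk : w ^+ k = p%:R) (k_lt : (k < p ^ t0.+1)%N).

Let w_ge0 : 0 <= w. Proof. exact: le_trans ler01 w_ge1. Qed.

(** Induction on [n - mu]. Passing to a critical residue raises [mu] by [s <= k], which costs at
    most [w ^ k = p]; averaging over residues mod [p] repays it. The degree factor is replaced by
    the multiplicity of the residue, and these multiplicities sum to at most the degree of [g] mod
    [p]. Keeping [w ^ n] on the left avoids negative exponents. *)
Lemma poly_char_sum_bound mu tau (h g : {poly int}) :
  h^`() = p%:Z ^+ tau *: g -> redp p g != 0 ->
  (1 < size (redp p h) <= k.+1)%N ->
  `|\sum_(0 <= j < p ^ n) psi (p%:Z ^+ mu * h.[j])| * w ^+ n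
    <= (maxn 1 (size (redp p g)).-1)%:R * w ^+ (mu + t0).+1 * (p ^ n)%:R.
Proof.
have [m] := ubnP (n - mu); elim: m => // m IHm in mu tau h g *.
move=> lt_m hg g0 h_size; set T := \sum_(_ <= _ < _) _.
(* For small [n] the trivial bound suffices. Otherwise [tau <= t0] gives [mu + tau + 2 <= n], as the
   cancellation at noncritical residues requires. *)
have [n_le|n_gt] := leqP n (mu + t0).+1.
  rewrite -mulrA mulrC -[leLHS]mul1r ler_pM ?mulr_ge0 ?exprn_ge0 //.
    by rewrite ler1n leq_maxl.
  rewrite ler_pM ?exprn_ge0 //; first exact: ler_weXn2l.
  exact: norm_char_sum_le psi_char _ _.
pose d := (size (redp p h)).-1.
have /andP[h_gt1 h_le] := h_size.
have tau_le : (tau <= t0)%N.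
  apply: (@deriv_content_le p h g tau d) => //; first by rewrite /d; lia.
    rewrite -(intr_Fp_eq0 p_prime) -[X in X != 0]coef_map -lead_coefE.
    by rewrite lead_coef_eq0 -size_poly_gt0 (ltn_trans _ h_gt1).
  by apply: leq_ltn_trans k_lt; rewrite /d; lia.
pose nu xi := mup xi (redp p g).
pose G j := psi (p%:Z ^+ mu * h.[j%:Z]).
pose M : C := w ^+ (mu + k + t0).+1 * (p ^ n)%:R.
have M_ge0 : 0 <= M by rewrite mulr_ge0 ?exprn_ge0.
have class_bound xi : `|\sum_(0 <= t < p ^ n) G (xi + p * t)%N| * w ^+ n
    <= (nu (xi%:Z%:~R))%:R * M.
  have [g_xi|g_xi] := boolP (p %| g.[xi])%Z; last first.
    rewrite (noncritical_sum_eq0 p_prime p_odd psi_char hg _ g_xi); last lia.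
    by rewrite normr0 mul0r mulr_ge0.
  have nu_gt0 : (0 < nu (xi%:Z%:~R))%N.
    rewrite /nu -XsubC_dvd // dvdp_XsubCl /root horner_map /=.
    by rewrite (intr_Fp_eq0 p_prime).
  have [s [h1 [tau1 [g1 [[hE /andP[s_gt0 s_le] h1g1 g1_0] [h1_size g1_le]]]]]] :=
    critical_point_rescale xi p_prime hg g0 h_size.
  have -> : \sum_(0 <= t < p ^ n) G (xi + p * t)%N
      = psi (p%:Z ^+ mu * h.[xi])
        * \sum_(0 <= t < p ^ n) psi (p%:Z ^+ (mu + s) * h1.[t]).
    case: psi_char => psiD _ _; rewrite mulr_sumr; apply: eq_bigr => t _.
    by rewrite /G PoszD PoszM hE mulrDr psiD mulrA -exprD.
  case: psi_char => _ psi_norm _; rewrite normrM psi_norm mul1r.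
  have lt_m' : (n - (mu + s) < m)%N by lia.
  apply: le_trans (IHm _ _ _ _ lt_m' h1g1 g1_0 h1_size) _.
  rewrite -mulrA ler_pM ?mulr_ge0 ?exprn_ge0 //.
    (* A critical residue has multiplicity at least 1, so the [maxn 1] is absorbed. *)
    by rewrite ler_nat geq_max nu_gt0 -subn1 leq_subLR add1n.
  by rewrite ler_wpM2r // ler_weXn2l //; lia.
have p_gt0 : (0 < p%:R :> C) by rewrite ltr0n prime_gt0.
rewrite -(ler_pM2l p_gt0) mulrA -{1}[p%:R]ger0_norm ?(ltW p_gt0) // -normrM.
have -> : p%:R * T = \sum_(0 <= xi < p) \sum_(0 <= t < p ^ n) G (xi + p * t)%N.
  rewrite mulr_natl; apply/esym.
  exact: (sum_periodic_residues (psi_poly_periodic psi_char h mu)).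
apply: (@le_trans _ _ (\sum_(0 <= xi < p) (nu (xi%:Z%:~R))%:R * M)).
  rewrite mulrC; apply: le_trans (ler_wpM2l _ (ler_norm_sum _ _ _)) _.
    exact: exprn_ge0.
  by rewrite mulr_sumr; apply: ler_sum => xi _; rewrite mulrC class_bound.
rewrite -mulr_suml -natr_sum /M (_ : _.+1 = k + (mu + t0).+1)%N; last lia.
rewrite exprD wk -!mulrA mulrCA ler_wpM2l // ler_wpM2r ?mulr_ge0 ?exprn_ge0 //.
rewrite ler_nat (leq_trans _ (leq_maxr _ _)) //.
rewrite -(big_map (fun xi : nat => xi%:Z%:~R : 'F_p) predT nu).
apply: sum_mup_le => //; rewrite map_inj_in_uniq ?iota_uniq //.
move=> x y; rewrite !mem_iota /= !add0n subn0 => x_lt y_lt /eqP.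
rewrite -subr_eq0 -rmorphB /= (intr_Fp_eq0 p_prime) -eqz_mod_dvd !modz_nat.
by rewrite !modn_small // => /eqP[].
Qed.

End CoreBound.

Lemma poly_char_sum_degree_bound (C : numFieldType) (p n k t0 L i0 : nat)
    (psi : int -> C) (w : C) (f : {poly int}) :
  prime p -> odd p -> additive_character (p ^ n) psi ->
  1 <= w -> w ^+ k = p%:R -> (k < p ^ t0.+1)%N ->
  (0 < i0 <= k)%N -> ~~ (p%:Z ^+ L.+1 %| f`_i0)%Z ->
  (forall i, (k < i)%N -> (p%:Z ^+ L.+1 %| f`_i)%Z) ->
  (forall i, (k + t0 < i)%N -> (p%:Z ^+ (L + t0).+1 %| f`_i)%Z) ->
  `|\sum_(0 <= j < p ^ n) psi f.[j]| * w ^+ n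
    <= (k + t0)%:R * w ^+ (L + t0).+1 * (p ^ n)%:R.
Proof.
move=> p_pr p_odd psi_char w_ge1 wk k_lt /andP[i0_gt0 i0_le] f_i0 f_k f_kt0.
have w_ge0 : 0 <= w by exact: le_trans ler01 w_ge1.
pose e := f - (f`_0)%:P.
have eE i : e`_i = if i == 0 then 0 else f`_i.
  rewrite coefB coefC; case: eqP => [->|_]; first by rewrite subrr.
  by rewrite subr0.
have e_i0 : e`_i0 = f`_i0 by rewrite eE gtn_eqF.
have e_neq0 : e != 0.
  apply: contra f_i0 => /eqP e0; have := e_i0.
  by rewrite e0 coef0 => <-; rewrite dvdz0.
have [mu [h [hE h_neq0]]] := redp_content p_pr e_neq0.
have h_i i : p%:Z ^+ mu * h`_i = e`_i by rewrite hE coefZ.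
have h_0 : h`_0 = 0.
  have /eqP := h_i 0; rewrite eE eqxx mulf_eq0.
  by rewrite (negPf (pzX_neq0 p_pr mu)) => /eqP.
have mu_le : (mu <= L)%N.
  rewrite leqNgt; apply: contra f_i0 => lt_L.
  by rewrite -e_i0 -h_i dvdz_mulr // dvdz_exp2l.
have h_dvd a i : (0 < i)%N -> (p%:Z ^+ (L + a).+1 %| f`_i)%Z ->
    (p%:Z ^+ a.+1 %| h`_i)%Z.
  move=> i_gt0 f_i; have := f_i; rewrite -[f`_i](_ : e`_i = _); last first.
    by rewrite eE gtn_eqF.
  rewrite -h_i => dvd_i; rewrite -(dvdz_mul2l (pzX_neq0 p_pr mu)).
  by apply: dvdz_trans dvd_i; rewrite -exprD dvdz_exp2l //; lia.
have h_gt1 : (1 < size (redp p h))%N.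
  rewrite ltnNge; apply: contra h_neq0 => /size_redp_leP-/(_ p_pr) H.
  by apply/redp_eq0P => // -[|i]; [rewrite h_0 dvdz0 | apply: H].
have h_le : (size (redp p h) <= k.+1)%N.
  apply/size_redp_leP => // i lt_i; rewrite -[p%:Z]expr1.
  by apply: h_dvd; [apply: leq_ltn_trans lt_i | rewrite addn0 f_k].
pose d := (size (redp p h)).-1.
have d_gt0 : (0 < d)%N by rewrite -ltnS prednK // ltnW.
have h_d : ~~ (p %| h`_d)%Z.
  rewrite -(intr_Fp_eq0 p_pr) -[X in X != 0]coef_map -lead_coefE.
  by rewrite lead_coef_eq0.
have h'_neq0 : h^`() != 0.
  apply: contra h_d => /eqP/polyP/(_ d.-1); rewrite coef_deriv prednK // coef0.
  by move=> /eqP; rewrite mulrn_eq0 gtn_eqF //= => /eqP ->; rewrite dvdz0.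
have [tau [g [hg g_neq0]]] := redp_content p_pr h'_neq0.
have tau_le : (tau <= t0)%N.
  apply: (deriv_content_le p_pr hg d_gt0 h_d); apply: leq_ltn_trans k_lt.
  by rewrite -ltnS prednK // ltnW.
have g_le : (size (redp p g) <= k + t0)%N.
  apply/size_redp_leP => // j le_j.
  rewrite -(dvdz_mul2l (pzX_neq0 p_pr tau)) -exprSr -coefZ -hg coef_deriv.
  rewrite -mulr_natr dvdz_mulr //.
  apply: (@dvdz_trans (p%:Z ^+ t0.+1)); first by rewrite dvdz_exp2l.
  by apply: h_dvd => //; apply: f_kt0.
have -> : \sum_(0 <= j < p ^ n) psi f.[j%:Z]
    = psi f`_0 * \sum_(0 <= j < p ^ n) psi (p%:Z ^+ mu * h.[j%:Z]).
  case: psi_char => psiD _ _; rewrite mulr_sumr; apply: eq_bigr => j _.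
  rewrite -psiD -hornerZ -hE /e hornerD hornerN hornerC.
  by rewrite [in RHS]addrC subrK.
have := poly_char_sum_bound p_pr p_odd psi_char w_ge1 wk k_lt mu hg g_neq0.
rewrite h_gt1 => /(_ h_le) bound.
case: psi_char => _ psi_norm _; rewrite normrM psi_norm mul1r.
apply: le_trans bound _; rewrite ler_wpM2r // ler_pM ?exprn_ge0 //.
  by rewrite ler_nat geq_max; lia.
by rewrite ler_weXn2l // ltnS leq_add2r.
Qed.

(** * Arithmetic and sums in Z/p^n *)

Section ZmodPn.
Variables p n : nat.
Hypotheses (p_prime : prime p) (n_gt0 : (0 < n)%N).

Let N_gt1 : (1 < p ^ n)%N.
Proof. by rewrite -(exp1n n) ltn_exp2r // prime_gt1. Qed.

Lemma val_natr_pn m : (m%:R : 'Z_(p ^ n)) = (m %% p ^ n)%N :> nat.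
Proof. exact: val_Zp_nat. Qed.

Lemma ltn_val_pn (y : 'Z_(p ^ n)) : (y < p ^ n)%N.
Proof. by have := ltn_ord y; rewrite {2}Zp_cast. Qed.

Lemma pdvdE e (y : 'Z_(p ^ n)) : (e <= n)%N -> pdvd e y = (p ^ e %| y)%N.
Proof.
move=> le_en; apply/existsP/idP => [[c /eqP ->]|/dvdnP[q yE]].
  rewrite -[c]natr_Zp -natrX -natrM val_natr_pn.
  rewrite /dvdn modn_dvdm ?dvdn_exp2l //.
  by rewrite mulnC modnMl.
by exists q%:R; rewrite -[y]natr_Zp yE natrM natrX mulrC.
Qed.

Lemma pn_dvd_eq0 (y : 'Z_(p ^ n)) : (p ^ n %| y)%N -> y = 0.
Proof.
move=> /eqP; rewrite modn_small ?ltn_val_pn // => y0.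
by rewrite -[y]natr_Zp y0.
Qed.

Lemma intr_pn_eq (a : int) (y : 'Z_(p ^ n)) :
  a%:~R = y -> (p%:Z ^+ n %| y%:Z - a)%Z.
Proof.
have natr0 m : (m%:R == 0 :> 'Z_(p ^ n)) = (p ^ n %| m)%N.
  by rewrite -val_eqE /= val_natr_pn.
move=> aE; have : ((y%:Z - a)%:~R : 'Z_(p ^ n)) == 0.
  by rewrite rmorphB /= aE -pmulrn natr_Zp subrr.
rewrite -[p%:Z]natz -natrX natz /dvdz /=.
case: (y%:Z - a) => m; first by rewrite natr0.
by rewrite NegzE rmorphN oppr_eq0 natr0.
Qed.

Lemma sum_pn (V : nmodType) (G : 'Z_(p ^ n) -> V) :
  \sum_t G t = \sum_(0 <= j < p ^ n) G j%:R.
Proof.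
transitivity (\sum_(0 <= j < (Zp_trunc (p ^ n)).+2) G j%:R).
  by rewrite big_mkord; apply: eq_bigr => t _; rewrite natr_Zp.
by apply: congr_big => //; rewrite Zp_cast.
Qed.

Lemma sum_translate (V : nmodType) (A : {set 'Z_(p ^ n)}) c
    (G : 'Z_(p ^ n) -> V) :
  (forall x, (x + c \in A) = (x \in A)) ->
  \sum_(x in A) G (x + c) = \sum_(x in A) G x.
Proof.
move=> Ac; rewrite [RHS](reindex_inj (addIr c)) /=.
by apply: eq_bigl => x; rewrite Ac.
Qed.

End ZmodPn.

(** A value below [n] comes neither from the default value nor from the truncation at [n]. *)
Lemma bigmin_attained (I : eqType) (r : seq I) (m : I -> nat) n :
  (\big[minn/n]_(i <- r) minn n (m i) < n)%N ->
  exists2 i, i \in r & \big[minn/n]_(i <- r) minn n (m i) = m i.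
Proof.
elim: r => [|i r IHr]; first by rewrite big_nil ltnn.
rewrite big_cons; set M := \big[_/_]_(_ <- _) _ in IHr *.
case: (leqP (minn n (m i)) M) => [le_M lt_n|lt_M lt_n].
  exists i; first exact: mem_head.
  by move: lt_n; rewrite gtn_min ltnn /= => /ltnW/minn_idPr.
have [j j_r ->] := IHr lt_n.
by exists j => //; rewrite inE j_r orbT.
Qed.

(** * From the class of functions to polynomial sums on progressions *)

Section ClassSum.
Variables (C : numFieldType) (p n k : nat) (psi : int -> C) (w b : C).
Variables (rho : nat -> nat -> nat) (A : {set 'Z_(p ^ n)}).
Variables (F : 'Z_(p ^ n) -> 'Z_(p ^ n)) (Ft : nat -> 'Z_(p ^ n) -> 'Z_(p ^ n)).
Hypotheses (p_prime : prime p) (p_odd : odd p) (n_gt0 : (0 < n)%N).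
Hypotheses (k_gt0 : (0 < k)%N) (F_class : in_class rho k A F Ft).
Hypothesis psi_char : additive_character (p ^ n) psi.
Hypotheses (w_ge1 : 1 <= w) (wk : w ^+ k = p%:R).
(** If [eps] holds, the step is [p ^ (kappa0 + 1)] and [eps * k = k] serves as [t0]; otherwise the
    step is [p ^ kappa0] and [t0 = 0], with [k < p]. *)
Variable eps : bool.
Hypothesis k_lt : (k < p ^ (eps * k).+1)%N.

Let kap := (kappa0 rho k p + eps)%N.
Let w_ge0 : 0 <= w. Proof. exact: le_trans ler01 w_ge1. Qed.

Lemma shift_in_A x t : x \in A -> x + p%:R ^+ kap * t \in A.
Proof. by move=> xA; rewrite /kap exprD -mulrA (class_domain F_class). Qed.

Lemma shift_mem_A x t : (x + p%:R ^+ kap * t \in A) = (x \in A).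
Proof.
apply/idP/idP; last exact: shift_in_A.
by move/(shift_in_A (- t)); rewrite mulrN addrK.
Qed.

(** Taken at order [j = n - 1], the Taylor congruence has modulus [p ^ n] because [n * kap >= n], so
    it is an equality; [1 <= j] requires [n > 1]. *)
Lemma class_shiftE x t : (1 < n)%N -> x \in A ->
  F (x + p%:R ^+ kap * t) = \sum_(i < n) Ft i x * p%:R ^+ (i * kap) * t ^+ i.
Proof.
move=> n_gt1 xA; rewrite -(class_system0 F_class) ?shift_in_A //.
have kap_ge : (kappa0 rho k p <= kap)%N by rewrite leq_addr.
have kap_gt0 : (0 < kap)%N by [].
have j_lt : (1 <= n.-1 < n)%N by lia.
have := class_taylor F_class 0 t xA kap_ge j_lt.
rewrite prednK // (minn_idPr _) ?leq_pmulr // pdvdE //.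
move/pn_dvd_eq0 => /(_ p_prime n_gt0)/eqP; rewrite subr_eq0 fact0 mulr1n.
move=> /eqP ->; apply: eq_bigr => i _.
by rewrite add0n ffactn0 mulr1n.
Qed.

Lemma class_shift_sum_le x : x \in A ->
  `|\sum_t psi (F (x + p%:R ^+ kap * t) : nat)%:Z| * w ^+ n
    <= (k.*2)%:R * w ^+ (Delta_at k Ft x + k * kap + eps * k).+1 * (p ^ n)%:R.
Proof.
move=> xA; set delta := Delta_at k Ft x; set L := (delta + k * kap)%N.
rewrite sum_pn //.
(* The trivial bound disposes of the degenerate cases [n = 1] and [delta = n]. *)
have [n_le|n_gt] := leqP n (L + eps * k).+1.
  rewrite -mulrA mulrC -[leLHS]mul1r ler_pM ?mulr_ge0 ?exprn_ge0 //.
    by rewrite ler1n; lia.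
  rewrite ler_pM ?exprn_ge0 //; first exact: ler_weXn2l.
  exact: norm_char_sum_le psi_char _ _.
have delta_lt : (delta < n)%N by rewrite /L in n_gt; lia.
have n_gt1 : (1 < n)%N by lia.
pose a i : int := (Ft i x : nat)%:Z * p%:Z ^+ (i * kap).
(* This range contains every degree up to [k]; the terms of degree at least [n] vanish mod
   [p ^ n]. *)
pose f := \poly_(i < (n + k).+1) a i.
have f_char j : psi (F (x + p%:R ^+ kap * j%:R) : nat)%:Z = psi f.[j%:Z].
  apply: (psi_eq psi_char); apply: intr_pn_eq => //.
  rewrite class_shiftE // horner_poly rmorph_sum /=.
  rewrite -(big_mkord xpredT
    (fun i => ((a i * j%:Z ^+ i)%:~R : 'Z_(p ^ n)))) /=.
  have aE i : (a i * j%:Z ^+ i)%:~R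
      = Ft i x * p%:R ^+ (i * kap) * j%:R ^+ i :> 'Z_(p ^ n).
    by rewrite /a !rmorphM !rmorphXn /= -!pmulrn natr_Zp.
  rewrite (@big_cat_nat _ _ _ n) /=; last 2 first.
  - by [].
  - by rewrite ltnW // ltnS leq_addr.
  rewrite big_mkord [X in _ + X]big_nat_cond [X in _ + X]big1 ?addr0.
    by apply: eq_bigr => i _; rewrite aE.
  move=> i /andP[/andP[le_i _] _]; rewrite aE.
  suff -> : (p%:R : 'Z_(p ^ n)) ^+ (i * kap) = 0 by rewrite mulr0 mul0r.
  apply: pn_dvd_eq0 => //; rewrite -natrX val_natr_pn //.
  rewrite /dvdn modn_dvdm // -/(dvdn _ _) dvdn_exp2l //.
  by rewrite (leq_trans le_i) // leq_pmulr.
rewrite (eq_bigr (fun j => psi f.[j%:Z])) => [|j _]; last exact: f_char.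
have [i0 i0_r deltaE] := bigmin_attained delta_lt.
move: i0_r; rewrite mem_index_iota ltnS => i0_r.
have /andP[i0_gt0 i0_le] := i0_r.
have f_i i : (i <= n + k)%N -> f`_i = a i by move=> ?; rewrite coef_poly ltnS ifT.
(* The tail condition consumes [(i - k) * kappa0] of the exponent [i * kap]; what is left is
   [k * kap + eps * (i - k)]. The last summand is the gain from the longer step. *)
have tail i : (k < i)%N ->
    (p%:Z ^+ (delta + k * kap + eps * (i - k)).+1 %| f`_i)%Z.
  move=> lt_ki; rewrite coef_poly; case: ifP => // _.
  have := class_tail F_class xA lt_ki.
  rewrite (minn_idPr _) // pdvdE // -[Ft i x]natr_Zp -natrX -natrM.
  rewrite val_natr_pn // /dvdn modn_dvdm ?dvdn_exp2l // -/(dvdn _ _).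
  move=> dvd_i; rewrite /a -!natz -!natrX -natrM !natz.
  have -> : (delta + k * kap + eps * (i - k)).+1
      = (delta.+1 + (k * kap + eps * (i - k)))%N by lia.
  have -> : (i * kap = (i - k) * kappa0 rho k p + (k * kap + eps * (i - k)))%N.
    by rewrite /kap; nia.
  rewrite !expnD mulnA [(_ * p ^ ((i - k) * _))%N]mulnC.
  exact: (dvdn_mul dvd_i).
(* At the index attaining the minimum the order is exactly [delta], and [i0 * kap <= k * kap]. *)
have fi0 : ~~ (p%:Z ^+ L.+1 %| f`_i0)%Z.
  rewrite f_i; last by rewrite (leq_trans i0_le) // leq_addl.
  have Ft_i0 : ~~ (p ^ delta.+1 %| Ft i0 x)%N.
    rewrite -pdvdE //; apply/negP => dvd_i0.
    have lt_n1 : (delta.+1 < n.+1)%N by [].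
    have : (delta.+1 <= pord (Ft i0 x))%N.
      exact: (@leq_bigmax_cond _ (fun e : 'I_n.+1 => pdvd e (Ft i0 x))
        (fun e => e : nat) (Ordinal lt_n1) dvd_i0).
    by rewrite -deltaE ltnn.
  apply: contra Ft_i0; rewrite /a -!natz -!natrX -natrM !natz => dvd_i0.
  have := dvd_i0; rewrite -(@dvdn_pmul2r (p ^ (i0 * kap))) ?expn_gt0 ?prime_gt0 //.
  apply: dvdn_trans; rewrite -expnD dvdn_exp2l // /L.
  by rewrite addSn ltnS leq_add2l leq_mul2r i0_le orbT.
have bound := poly_char_sum_degree_bound p_prime p_odd psi_char w_ge1 wk k_lt
  i0_r fi0.
apply: le_trans (bound _ _) _.
- by move=> i /tail; apply: dvdz_trans; rewrite dvdz_exp2l // ltnS leq_addr.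
- move=> i lt_i; apply: dvdz_trans (tail i _); last lia.
  by rewrite dvdz_exp2l // ltnS leq_add2l leq_mul2l; lia.
rewrite -!mulrA ler_wpM2r ?mulr_ge0 ?exprn_ge0 //.
by rewrite ler_nat; case: (eps); lia.
Qed.

(** Since [A] and [g] are invariant under the translations by [p ^ kap * t], the sum may be averaged
    over [t]. The bound for each progression is then summed over at most [p ^ n] points. *)
Lemma class_sum_le (g : 'Z_(p ^ n) -> C) :
  (forall x t, x \in A -> g (x + p%:R ^+ kappa0 rho k p * t) = g x) ->
  (forall x, x \in A -> `|g x| <= b) -> 0 <= b ->
  `|\sum_(x in A) g x * psi (F x : nat)%:Z| * w ^+ n
    <= b * (k.*2)%:R * w ^+ (Delta k A Ft).+1
       * p%:R ^+ (kappa0 rho k p + eps * 2) * (p ^ n)%:R.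
Proof.
move=> g_inv g_le b_ge0; set S := \sum_(x in A) _.
pose M : C := k.*2%:R * w ^+ (Delta k A Ft + k * kap + eps * k).+1 * (p ^ n)%:R.
have avg : (p ^ n)%:R * S
    = \sum_(x in A) g x * \sum_t psi (F (x + p%:R ^+ kap * t) : nat)%:Z.
  transitivity (\sum_(t : 'Z_(p ^ n)) S).
    by rewrite sum_pn // sumr_const_nat subn0 mulr_natl.
  under [RHS]eq_bigr => x _ do rewrite mulr_sumr.
  rewrite [RHS]exchange_big /=; apply: eq_bigr => t _.
  rewrite /S; pose G x := g x * psi (F x : nat)%:Z.
  transitivity (\sum_(x in A) G (x + p%:R ^+ kap * t)).
    by apply/esym; apply: (@sum_translate p n C A _ G) => x; apply: shift_mem_A.
  apply: eq_bigr => x xA; rewrite /G; congr (_ * _).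
  by rewrite /kap exprD -mulrA g_inv.
have N_gt0 : 0 < (p ^ n)%:R :> C by rewrite ltr0n expn_gt0 prime_gt0.
have sum_le : (p ^ n)%:R * (`|S| * w ^+ n) <= (p ^ n)%:R * (b * M).
  rewrite mulrA -[X in X * `|S|]ger0_norm ?(ltW N_gt0) // -normrM avg.
  apply: le_trans (ler_wpM2r (exprn_ge0 _ w_ge0) (ler_norm_sum _ _ _)) _.
  rewrite mulr_suml.
  apply: (@le_trans _ _ (\sum_(x in A) b * M)).
    apply: ler_sum => x xA; rewrite normrM -mulrA ler_pM ?mulr_ge0 ?exprn_ge0 //.
      exact: g_le.
    apply: le_trans (class_shift_sum_le xA) _.
    rewrite /M ler_wpM2r ?ler_wpM2l ?ler_weXn2l // ltnS -!addnA leq_add2r.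
    exact: leq_bigmax_cond.
  rewrite sumr_const -[leLHS]mulr_natl ler_wpM2r ?mulr_ge0 ?exprn_ge0 //.
  rewrite ler_nat; apply: leq_trans (max_card _) _; rewrite card_ord Zp_cast //.
  by rewrite -(exp1n n) ltn_exp2r // prime_gt1.
move: sum_le; rewrite ler_pM2l //; congr (_ <= _).
rewrite /M !mulrA; congr (_ * _); rewrite -!mulrA; congr (_ * (_ * _)).
(* The excess over [Delta + 1] is a multiple of [k], so it becomes a power of [p = w ^ k]. *)
have -> : ((Delta k A Ft + k * kap + eps * k).+1
    = (Delta k A Ft).+1 + k * (kappa0 rho k p + eps * 2))%N.
  by rewrite /kap; case: (eps); lia.
by rewrite exprD exprM wk.
Qed.

End ClassSum.

(** * The function e(z) as an additive character *)

Lemma e2pi_real (R : realType) (r : R) :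
  e2pi r%:C = cos (2 * pi * r) +i* sin (2 * pi * r).
Proof.
rewrite /e2pi /cexp.
have -> : 2 * pi%:C * 'i * r%:C = 0 +i* (2 * pi * r) :> R[i].
  by simpc.
by rewrite /= expR0 mul1r.
Qed.

Lemma e2piD (R : realType) (r s : R) :
  e2pi (r + s)%:C = e2pi r%:C * e2pi s%:C.
Proof.
by rewrite !e2pi_real mulrDr cosD sinD; simpc; congr (_ +i* _); rewrite addrC.
Qed.

Lemma norm_e2pi (R : realType) (r : R) : `|e2pi r%:C| = 1.
Proof. by rewrite e2pi_real normc_def /= cos2Dsin2 sqrtr1. Qed.

Lemma e2pi_int (R : realType) (m : int) : e2pi (m%:~R : R)%:C = 1.
Proof.
have e2pi1 : e2pi (1 : R)%:C = 1.
  by rewrite e2pi_real mulr1 mulr_natl cos2pi sin2pi.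
have nat1 k : e2pi (k%:R : R)%:C = 1.
  elim: k => [|k IHk]; first by rewrite e2pi_real mulr0 cos0 sin0.
  by rewrite -addn1 natrD e2piD IHk e2pi1 mulr1.
case: m => k; first exact: nat1.
have := nat1 k.+1; rewrite NegzE => E.
have : e2pi (0 : R)%:C = 1 by exact: (nat1 0).
by rewrite -(subrr (k.+1%:R : R)) e2piD E mul1r rmorphN.
Qed.

(** The real part is [1 - 2 * sin (pi * r) ^ 2], and the sine is positive on this range. *)
Lemma e2pi_neq1 (R : realType) (r : R) : 0 < r < 1 -> e2pi r%:C != 1.
Proof.
move=> /andP[r0 r1]; rewrite e2pi_real; apply/negP => /eqP[].
have : 0 < sin (pi * r).
  apply: sin_gt0_pi; rewrite mulr_gt0 ?pi_gt0 //=.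
  by rewrite -[ltRHS]mulr1 ltr_pM2l // pi_gt0.
move=> sin_gt0 cos1 _; have := cos_mulr2n (pi * r).
have -> : (pi * r) *+ 2 = 2 * pi * r by rewrite -mulrA mulr_natl.
rewrite cos1; have := cos2Dsin2 (pi * r); move: sin_gt0.
by move: (cos _) (sin _) => c s; nra.
Qed.

Lemma e2pi_additive_character (R : realType) N : (0 < N)%N ->
  additive_character N (fun a : int => e2pi ((a%:~R : R) / N%:R)%:C).
Proof.
move=> N_gt0; have N_neq0 : N%:R != 0 :> R by rewrite pnatr_eq0 -lt0n.
have e2pi_mul q : e2pi ((q * N%:Z)%:~R / N%:R : R)%:C = 1.
  by rewrite intrM mulfK // e2pi_int.
split=> [a b|a|a].
- by rewrite intrD mulrDl e2piD.
- exact: norm_e2pi.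
rewrite {1}(divz_eq a N) intrD mulrDl e2piD e2pi_mul mul1r.
have r_ge0 : 0 <= (a %% N)%Z by rewrite modz_ge0 // -lt0n.
have r_lt : (a %% N)%Z < N by rewrite ltz_pmod.
apply/idP/dvdz_mod0P => [|->]; last by rewrite mul0r (e2pi_int R 0).
apply: contraTeq => r_neq0; apply: e2pi_neq1.
have N_gt0' : 0 < N%:R :> R by rewrite ltr0n.
rewrite divr_gt0 //=; last by rewrite ltr0z lt_neqAle eq_sym r_neq0.
by rewrite ltr_pdivrMr // mul1r -[N%:R]/(N%:Z%:~R) ltr_int.
Qed.

(** * Choice of the constant and passage to the real exponent *)

Theorem proposition5p3 (R : realType) (rho : nat -> nat -> nat)
    (rho_eventually0 : forall k : nat, (1 <= k)%N ->
       exists p0 : nat, forall p : nat, prime p -> (p0 <= p)%N -> rho k p = 0%N)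
    (k : nat) (k_gt0 : (1 <= k)%N) (B : R) :
  exists C : R,
  forall (p n : nat) (A : {set 'Z_(p ^ n)})
    (F : 'Z_(p ^ n) -> 'Z_(p ^ n)) (Ft : nat -> 'Z_(p ^ n) -> 'Z_(p ^ n))
    (g : 'Z_(p ^ n) -> R[i]),
    prime p -> odd p -> (1 <= n)%N ->
    in_class rho k A F Ft ->
    (forall x t : 'Z_(p ^ n), x \in A ->
       g (x + p%:R ^+ kappa0 rho k p * t) = g x) ->
    (forall x : 'Z_(p ^ n), x \in A -> `|g x| <= B%:C) ->
    `|\sum_(x in A) g x * e2pi ((F x : nat)%:R / (p ^ n)%:R)|
      <= (C * p%:R `^ (n%:R - (n%:R - (Delta k A Ft)%:R - 1) / k%:R + 1))%:C.
Proof.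
(* From [P] on, both [rho k p = 0] and [k < p] hold. [K] dominates the loss at each prime below [P],
   and its successor makes it at least 1 for the others. *)
have [p0 rho0] := rho_eventually0 k k_gt0; pose P := maxn k.+1 p0.
pose K := ((\sum_(q < P) q ^ (rho k q + 2)).+1)%N.
(* [B] may be negative when [A] is empty, hence the absolute value. *)
exists (`|B| * k.*2%:R * K%:R) => p n A F Ft g p_pr p_odd n_gt0 F_class g_inv g_le.
pose eps := (p < P)%N.
have p_gt0 : 0 < p%:R :> R by rewrite ltr0n prime_gt0.
have K_ge : (p ^ (rho k p + eps * 2) <= K)%N.
  rewrite /eps; case: (ltnP p P) => [lt_p|le_P].
    by rewrite mul1n /K (bigD1 (Ordinal lt_p)) //= -addSn ltnW // ltnS leq_addr.
  by rewrite rho0 // (leq_trans _ le_P) // leq_maxr.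
have k_lt : (k < p ^ (eps * k).+1)%N.
  rewrite /eps; case: (ltnP p P) => [_|le_P].
    by rewrite mul1n; apply: ltnW; apply: ltn_expl; apply: prime_gt1.
  by rewrite mul0n expn1; apply: leq_trans le_P; rewrite leq_maxl.
pose u : R := p%:R `^ k%:R^-1.
have k_neq0 : k%:R != 0 :> R by rewrite pnatr_eq0 -lt0n.
have u_ge1 : 1 <= u.
  by rewrite -(powRr0 p%:R) ler_powR ?invr_ge0 // ler1n prime_gt0.
have uX m : u ^+ m = p%:R `^ (m%:R / k%:R).
  by rewrite -powR_mulrn ?powR_ge0 // -powRrM mulrC.
have uk : u ^+ k = p%:R by rewrite uX divff // powRr1 // ltW.
have pn_gt0 : (0 < p ^ n)%N by rewrite expn_gt0 prime_gt0.
have psi_char := e2pi_additive_character R pn_gt0.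
have g_le' x : x \in A -> `|g x| <= `|B|%:C.
  by move=> /g_le /le_trans; apply; rewrite lecR ler_norm.
have b_ge0 : 0 <= `|B|%:C by rewrite lecR.
have uC_ge1 : 1 <= u%:C by rewrite -[1]/(1%:C) lecR.
have ukC : u%:C ^+ k = p%:R by rewrite -rmorphXn /= uk rmorph_nat.
have := class_sum_le p_pr p_odd n_gt0 k_gt0 F_class psi_char uC_ge1 ukC k_lt
  g_inv g_le' b_ge0.
rewrite (eq_bigr (fun x => g x * e2pi ((F x : nat)%:R / (p ^ n)%:R))); last first.
  by move=> x _; rewrite rmorphM fmorphV /= rmorph_int rmorph_nat.
set S := \sum_(x in A) _; rewrite normc_def; set T := Num.sqrt _.
rewrite -!(rmorph_nat (real_complex R)) -!(rmorphXn (real_complex R)).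
rewrite -!rmorphM !lecR => bound.
have un_gt0 : 0 < u ^+ n by rewrite exprn_gt0 // (lt_le_trans ltr01).
rewrite -(ler_pM2r un_gt0); apply: le_trans bound _.
set E := (X in p%:R `^ X).
(* With [u = p ^ (1 / k)], multiplying by [u ^ n] cancels the term [- n / k] of [E]. *)
have pE : p%:R `^ E * u ^+ n
    = u ^+ (Delta k A Ft).+1 * p%:R * (p ^ n)%:R.
  have p_neq0 : p%:R != 0 :> R by rewrite gt_eqF.
  rewrite !uX -[X in _ * X * _]powRr1 ?ltW // natrX -powR_mulrn ?ltW //.
  rewrite -!powRD ?p_neq0 ?implybT //; congr (_ `^ _).
  by rewrite /E -natr1; field.
(* As [kappa0 = 1 + rho k p], one factor [p] is the [+ 1] of the exponent; the rest,
   [p ^ (rho k p + eps * 2)], is at most [K]. *)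
rewrite -[leRHS]mulrA pE /kappa0 -addnA exprD expr1 -!mulrA.
rewrite ler_wpM2l // ler_wpM2l // [leRHS]mulrCA.
rewrite ler_wpM2l ?exprn_ge0 ?powR_ge0 // [leRHS]mulrCA.
by rewrite ler_wpM2l // ler_wpM2r // -natrX ler_nat.
Qed.
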